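(* Let $q$ be a prime power, $h\ge 1$, $k>3$, and let $C$ be an $\mathbb F_q$-linear $(n,q^{hk},n-k+1)_{q^h}$ MDS code over $\mathbb F_{q^h}$. Suppose there exist two subsets $A,B\subset[1,n]$ with $A\cap B=\varnothing$ and $|A|+|B|\le k-2$ such that the projections of $C$ from $A$ and from $B$ are $\mathbb F_q$-equivalent to linear codes. If $n>q+k$, then $C$ is $\mathbb F_q$-equivalent to an $\mathbb F_{q^s}$-linear code for some divisor $s>1$ of $h$. Moreover, if $n>q^e+k$, where $e$ is the largest divisor of $h$ strictly smaller than $h$, then $C$ is $\mathbb F_q$-equivalent to a linear code.
   Context: A code of length $n$ over $\mathbb F_{q^h}$ is a subset of $\mathbb F_{q^h}^n$; an $(n,M,d)_{q^h}$ code has $M$ codewords and minimum Hamming distance $d$. It is $\mathbb F_{q^s}$-linear (for a subfield $\mathbb F_{q^s}$) if it is an $\mathbb F_{q^s}$-subspace of $\mathbb F_{q^h}^n$, and linear if it is an $\mathbb F_{q^h}$-subspace. It is MDS if $M=q^{h(n-d+1)}$. Two $\mathbb F_q$-linear codes over $\mathbb F_{q^h}$ are $\mathbb F_q$-equivalent if one is obtained from the other by permuting coordinate positions and applying, in each coordinate position, an $\mathbb F_q$-linear bijection of $\mathbb F_{q^h}$ (possibly different in different positions). The projection of $C$ from position $i$ is $\{(x_1,\dots,x_{i-1},x_{i+1},\dots,x_n) : (x_1,\dots,x_{i-1},0,x_{i+1},\dots,x_n)\in C\}$; the projection from a set of positions is obtained by projecting consecutively from each of its positions. *)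

(* Defs.v *)
From HB Require Import structures.
From mathcomp Require Import all_boot all_order all_algebra.
From mathcomp Require Import perm.
Set Implicit Arguments. Unset Strict Implicit. Unset Printing Implicit Defensive.
Import GRing.Theory.
Local Open Scope ring_scope.

(* Codes of length n over the finite field L (playing the role of F_{q^h})
   are sets of row vectors 'rV[L]_n.  For m = q^s with s | h, the subfield
   F_{q^s} of L = F_{q^h} is the set of c with c ^+ m = c. *)

Section Codes.
Variable L : finFieldType.

Definition dH n (x y : 'rV[L]_n) : nat := #|[set i : 'I_n | x 0 i != y 0 i]|.

Definition min_dist n (C : {set 'rV[L]_n}) (d : nat) : Prop :=
  (exists x y, [/\ x \in C, y \in C, x != y & dH x y = d]) /\
  (forall x y, x \in C -> y \in C -> x != y -> (d <= dH x y)%N).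

(* C is linear over the subfield {c | c ^+ m = c} (m = q^s gives F_{q^s}) *)
Definition sub_linear (m : nat) n (C : {set 'rV[L]_n}) : Prop :=
  [/\ 0 \in C,
      (forall x y, x \in C -> y \in C -> x + y \in C) &
      (forall (c : L) x, c ^+ m = c -> x \in C -> c *: x \in C)].

Definition lin_code n (C : {set 'rV[L]_n}) : Prop :=
  [/\ 0 \in C,
      (forall x y, x \in C -> y \in C -> x + y \in C) &
      (forall (c : L) x, x \in C -> c *: x \in C)].

Definition Fq_linear_map (q : nat) (f : L -> L) : Prop :=
  (forall x y, f (x + y) = f x + f y) /\
  (forall c x, c ^+ q = c -> f (c * x) = c * f x).

Definition Fq_equiv (q : nat) n (C D : {set 'rV[L]_n}) : Prop :=
  exists (sigma : 'S_n) (phi : 'I_n -> L -> L),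
    (forall i, bijective (phi i) /\ Fq_linear_map q (phi i)) /\
    D = [set (\row_j phi j (x 0 (sigma j))) | x : 'rV[L]_n in C].

Definition proj n (C : {set 'rV[L]_n}) (A : {set 'I_n}) : {set 'rV[L]_#|~: A|} :=
  [set (\row_(j < #|~: A|) x 0 (enum_val j)) | x : 'rV[L]_n in [set x in C | [forall i in A, x 0 i == 0]]].

Definition equiv_to_linear (q : nat) n (C : {set 'rV[L]_n}) : Prop :=
  exists D : {set 'rV[L]_n}, lin_code D /\ Fq_equiv q C D.

End Codes.

Definition prime_power (q : nat) : Prop := exists p r, prime p /\ (0 < r)%N /\ q = (p ^ r)%N.

(* Main.v *)
(* Let V_A and V_B be the subcodes of C vanishing on A and on B.  Transporting the scalar
   action of L through the given equivalences, L acts on V_A and on V_B coordinate by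
   coordinate.  After enlarging A we have |A| + |B| = k - 2, so W = V_A \cap V_B has
   "dimension" 2 over L, and the n - k + 2 other coordinates give subspaces of W stable
   under both actions; their slopes lie in the intersection K of the two images of L in
   End(W).  Hence K is a field with at least n - k + 1 > q + 1 elements containing F_q,
   that is, K = F_{q^s} with s > 1.  The two K-actions agree on W, so they glue to a
   coordinatewise K-action on V_A + V_B = C. *)
Require Import Defs.
From HB Require Import structures.
From mathcomp Require Import all_boot all_order all_algebra.
From mathcomp Require Import perm fingroup cyclic finalg zify.
Set Implicit Arguments. Unset Strict Implicit. Unset Printing Implicit Defensive.
Import GRing.Theory.
Local Open Scope ring_scope.

(** * Subfields of a finite field *)

(** Modulo [p ^ a - 1], the number [p ^ b - 1] reduces to [p ^ (b %% a) - 1], which is too small to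
    be a nonzero multiple. *)
Lemma dvdn_predX_dvdn (p a b : nat) : (1 < p)%N -> (0 < a)%N ->
  ((p ^ a).-1 %| (p ^ b).-1 -> a %| b)%N.
Proof.
move=> p1 a0 dv; rewrite /dvdn; apply/eqP.
have rlt : (b %% a < a)%N by rewrite ltn_mod.
have pos m : (0 < p ^ m)%N by rewrite expn_gt0; lia.
have eq1 : ((p ^ b).-1 = p ^ (b %% a) * (p ^ (b %/ a * a)).-1 + (p ^ (b %% a)).-1)%N.
  rewrite {1}(divn_eq b a) expnD.
  have := pos (b %/ a * a)%N; have := pos (b %% a)%N.
  by case: (p ^ (b %% a))%N => // u _; case: (p ^ (b %/ a * a))%N => // v _ /=; lia.
move: dv; rewrite eq1 dvdn_addr; last first.
  by apply/dvdn_mull; rewrite mulnC expnM dvdn_pred_predX.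
have ltp : (p ^ (b %% a) < p ^ a)%N by rewrite ltn_exp2l.
have [//|r0] := posnP (b %% a)%N.
have r1 : (1 < p ^ (b %% a))%N by rewrite -[1%N](expn0 p) ltn_exp2l.
by move/dvdn_leq; lia.
Qed.

Section Subfields.
Variables (L : finFieldType) (K : {set L}).
Hypotheses (K0 : 0 \in K) (K1 : 1 \in K).
Hypothesis KD : forall x y, x \in K -> y \in K -> x + y \in K.
Hypothesis KM : forall x y, x \in K -> y \in K -> x * y \in K.

(** Multiplication by [c] permutes the nonzero elements of [K]; comparing their product before and
    after gives the claim. *)
Lemma subfield_unity c : c \in K -> c != 0 -> c ^+ #|K|.-1 = 1.
Proof.
move=> cK c0; pose S := K :\ (0 : L).
have cS : #|K|.-1 = #|S| by rewrite (cardsD1 0 K) K0.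
have imS : [set c * x | x in S] = S.
  apply/eqP; rewrite eqEcard card_imset ?leqnn ?andbT; last exact: mulfI.
  apply/subsetP=> _ /imsetP[x + ->]; rewrite !inE => /andP[x0 xK].
  by rewrite mulf_neq0 //= KM.
have P0 : \prod_(x in S) x != 0.
  by rewrite prodf_seq_neq0; apply/allP=> x _; rewrite !inE; apply/implyP=> /andP[].
apply: (mulIf P0); rewrite mul1r cS -[in LHS]prodr_const -big_split /=.
rewrite -[in RHS]imS big_imset //=; exact: in2W (mulfI c0).
Qed.

Lemma subfield_card_gt1 : (1 < #|K|)%N.
Proof.
apply: (@leq_trans #|[set (0 : L); 1]|); first by rewrite cards2 eq_sym oner_neq0.
by apply/subset_leq_card/subsetP=> x; rewrite !inE => /orP[] /eqP->.
Qed.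

Lemma subfield_prim_root : exists2 z, z \in K & #|K|.-1.-primitive_root z.
Proof.
have K2 := subfield_card_gt1.
have cS : #|K :\ (0 : L)| = #|K|.-1 by rewrite (cardsD1 0 K) K0.
have /hasP[z zS pz] : has #|K|.-1.-primitive_root (enum (K :\ (0 : L))).
  apply: has_prim_root; rewrite ?enum_uniq -?cardE ?cS //; first by lia.
  apply/allP=> x; rewrite mem_enum !inE => /andP[x0 xK].
  by rewrite unity_rootE subfield_unity.
by exists z => //; move: zS; rewrite mem_enum !inE => /andP[].
Qed.

(** The elements of [K] already exhaust the roots that a polynomial of degree [#|K|] can have. *)
Lemma subfield_fixed c : (c \in K) = (c ^+ #|K| == c).
Proof.
have K2 := subfield_card_gt1.
have fixK x : x \in K -> x ^+ #|K| = x.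
  have [-> _|x0 xK] := eqVneq x 0; first by rewrite expr0n; case: #|K| K2.
  by rewrite -(prednK (ltnW K2)) exprS subfield_unity ?mulr1.
apply/idP/eqP=> [/fixK //|cc]; apply: contraT => cK.
pose P : {poly L} := 'X^#|K| - 'X.
have szP : size P = #|K|.+1.
  by rewrite /P size_polyDl size_polyXn // size_polyN size_polyX.
have P0 : P != 0 by rewrite -size_poly_eq0 szP.
have := @max_poly_roots _ P (c :: enum K) P0.
rewrite /= mem_enum cK enum_uniq szP -cardE ltnn; apply=> //.
rewrite rootE !hornerE cc subrr eqxx /=; apply/allP=> x; rewrite mem_enum => /fixK xx.
by rewrite rootE !hornerE xx subrr.
Qed.

Lemma subfield_card_pfactor p N : prime p -> #|L| = (p ^ N)%N ->
  exists a, #|K| = (p ^ a)%N.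
Proof.
move=> pp cL.
have gK : group_set K by apply/group_setP; split=> // x y; exact: KD.
have := cardSg (subsetT (Group gK)); rewrite cardsT cL => /(dvdn_pfactor _ _ pp)[a _ /= ->].
by exists a.
Qed.

End Subfields.

(** Write [q = p ^ r] and [#|K| = p ^ a]. Orders of elements give two divisibilities: a generator of
    the nonzero elements of [K] lies in [L], so [a] divides [r * h]; an element of order [q - 1]
    lies in [K], so [r] divides [a]. Then [s = a / r]. *)
Lemma subfield_classification (L : finFieldType) (K : {set L}) (q h : nat) :
    prime_power q -> (0 < h)%N -> #|L| = (q ^ h)%N -> 0 \in K ->
    (forall x y, x \in K -> y \in K -> x + y \in K) ->
    (forall x y, x \in K -> y \in K -> x * y \in K) ->
    (forall c, c ^+ q = c -> c \in K) ->
  exists s, [/\ (s %| h)%N, #|K| = (q ^ s)%N & forall c, (c \in K) = (c ^+ (q ^ s) == c)].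
Proof.
move=> [p [r [pp [r0 qE]]]] h0 cL K0 KD KM Kq.
have p1 := prime_gt1 pp.
have K1 : 1 \in K by apply: Kq; rewrite expr1n.
have cLp : #|L| = (p ^ (r * h))%N by rewrite cL qE expnM.
have [a cK] := subfield_card_pfactor K0 KD pp cLp.
have K2 := subfield_card_gt1 K0 K1.
have a0 : (0 < a)%N by case: a cK K2 => // ->; rewrite expn0.
have q1 : (1 < q)%N by rewrite qE -[1%N](expn0 p) ltn_exp2l.
have T0 x : x != 0 :> L -> x ^+ (q ^ h).-1 = 1.
  by move=> x0; rewrite -cL -cardsT; apply: subfield_unity => // *; rewrite ?inE.
have nz m (z : L) : (0 < m)%N -> m.-primitive_root z -> z != 0.
  move=> m0 /prim_expr_order zm; apply/eqP=> z0; move: zm; rewrite z0 expr0n.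
  by case: m m0 => // m _ /eqP; rewrite eq_sym oner_eq0.
have [z zK pz] := subfield_prim_root K0 K1 KM.
have dva : (a %| r * h)%N.
  apply: (dvdn_predX_dvdn p1 a0); rewrite -cK -cLp cL (prim_order_dvd pz) T0 //.
  by apply: nz pz; lia.
have [g _ pg] := @subfield_prim_root L [set: L] (in_setT _) (in_setT _) (fun _ _ _ _ => in_setT _).
rewrite cardsT cL in pg.
(* A suitable power of the generator [g] has order exactly [q - 1], hence is fixed by the [q]-th
   power. *)
have {pg} := dvdn_prim_root pg (dvdn_pred_predX q h).
set c := g ^+ _ => pc.
have c0 : c != 0 by apply: nz pc; lia.
have cinK : c \in K.
  by apply: Kq; rewrite -(prednK (ltnW q1)) exprS (prim_expr_order pc) mulr1.
have : (r %| a)%N.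
  apply: (dvdn_predX_dvdn p1 r0); rewrite -cK -qE (prim_order_dvd pc).
  by rewrite (subfield_unity K0 KM).
case/dvdnP=> s aE; exists s.
have cKq : #|K| = (q ^ s)%N by rewrite cK qE aE mulnC expnM.
split=> // [|x]; first by move: dva; rewrite aE mulnC dvdn_pmul2l.
by rewrite (subfield_fixed K0 K1 KM) cKq.
Qed.

(** * Finite sets and interpolation in MDS codes *)

Lemma exists_intermediate_set (T : finType) (S U : {set T}) (m : nat) :
    S \subset U -> (#|S| <= m <= #|U|)%N ->
  exists S' : {set T}, [/\ S \subset S', S' \subset U & #|S'| = m].
Proof.
move=> sSU /andP[]; elim: m => [|m IH] Sm mU.
  by exists S; split=> //; apply/eqP; rewrite -leqn0.
move: Sm; rewrite leq_eqVlt => /predU1P[SmE|Sm]; first by exists S.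
have [S' [sSS' sS'U cS']] := IH Sm (ltnW mU).
have /properP[_ [x xU xS']] : S' \proper U by rewrite properEcard sS'U cS'.
exists (x |: S'); rewrite cardsU1 xS' cS' subUset sub1set xU sS'U.
by split=> //; rewrite (subset_trans sSS') // subsetUr.
Qed.

(** By finiteness, translation by [y] maps [C] onto itself, so [x] has the form [z + y] with [z] in
    [C]. *)
Lemma add_closed_sub (V : finZmodType) (C : {set V}) :
    (forall x y, x \in C -> y \in C -> x + y \in C) ->
  forall x y, x \in C -> y \in C -> x - y \in C.
Proof.
move=> CD x y xC yC.
have imC : [set z + y | z in C] = C.
  apply/eqP; rewrite eqEcard card_imset ?leqnn ?andbT; last exact: addIr.
  by apply/subsetP=> _ /imsetP[z zC ->]; exact: CD.
by move: xC; rewrite -{1}imC => /imsetP[z zC ->]; rewrite addrK.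
Qed.

Section MDSCodes.
Variables (L : finFieldType) (n k : nat) (C : {set 'rV[L]_n}).
Hypothesis kn : (k <= n)%N.
Hypothesis Ccard : #|C| = (#|L| ^ k)%N.
Hypothesis Cdist : forall x y, x \in C -> y \in C -> x != y -> (n - k + 1 <= dH x y)%N.

Lemma mds_uniq (S : {set 'I_n}) (x y : 'rV[L]_n) : (k <= #|S|)%N ->
  x \in C -> y \in C -> (forall i, i \in S -> x 0 i = y 0 i) -> x = y.
Proof.
move=> kS xC yC xy; apply/eqP/contraT=> /(Cdist xC yC); rewrite /dH.
set E := [set i | _] => dxy.
have : (#|E| <= #|~: S|)%N.
  apply/subset_leq_card/subsetP=> i; rewrite !inE; apply: contra => /xy ->; exact: eqxx.
by have := cardsC S; rewrite card_ord; lia.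
Qed.

(** Once [S] is enlarged to [k] positions, restriction to it is injective on [C] by [mds_uniq],
    hence onto by counting. *)
Lemma mds_interp (S : {set 'I_n}) (v : 'I_n -> L) : (#|S| <= k)%N ->
  exists2 x, x \in C & forall i, i \in S -> x 0 i = v i.
Proof.
move=> Sk; have [|S' [sSS' _ cS']] := @exists_intermediate_set _ S [set: 'I_n] k (subsetT _).
  by rewrite Sk cardsT card_ord.
pose r (x : 'rV[L]_n) := [ffun j : 'I_#|S'| => x 0 (enum_val j)].
have rE x y : r x = r y -> forall i, i \in S' -> x 0 i = y 0 i.
  move=> /ffunP rxy i iS; have := rxy (enum_rank_in iS i).
  by rewrite !ffunE enum_rankK_in.
have im : [set r x | x in C] = [set: {ffun 'I_#|S'| -> L}].
  apply/eqP; rewrite eqEcard subsetT card_in_imset.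
    by rewrite cardsT card_ffun card_ord cS' Ccard leqnn.
  by move=> x y xC yC /rE; apply: mds_uniq => //; rewrite cS'.
have : r (\row_i v i) \in [set r x | x in C] by rewrite im inE.
case/imsetP=> x xC rx; exists x => // i iS.
by rewrite -(rE _ _ rx) ?mxE // (subsetP sSS').
Qed.

End MDSCodes.

(** * Scalar actions transported to the coordinates *)

Section CoordinateActions.
Variables (L : finFieldType) (q n : nat).

(* The inverse bijections [phi i] and [psi i] turn the codewords vanishing on [A] into an
   L-linear code; their values for [i \in A] are irrelevant, as [psi i (c * phi i 0) = 0]. *)
Definition linearized (C : {set 'rV[L]_n}) (A : {set 'I_n}) (phi psi : 'I_n -> L -> L) :=
  [/\ forall i, cancel (phi i) (psi i), forall i, cancel (psi i) (phi i),
      forall i, Fq_linear_map q (phi i) &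
      forall c x, x \in C -> (forall i, i \in A -> x 0 i = 0) ->
        \row_i psi i (c * phi i (x 0 i)) \in C].

Lemma linearizedS C (A A' : {set 'I_n}) phi psi : A \subset A' ->
  linearized C A phi psi -> linearized C A' phi psi.
Proof.
move=> sAA' [phiK psiK philin act]; split=> // c x xC x0.
by apply: act => // i iA; apply: x0; apply: (subsetP sAA').
Qed.

Lemma Fq_linear_map0 (f : L -> L) : Fq_linear_map q f -> f 0 = 0.
Proof. by case=> fD _; apply: (addrI (f 0)); rewrite -fD !addr0. Qed.

Lemma Fq_linear_map_can (f g : L -> L) :
  cancel f g -> cancel g f -> Fq_linear_map q f -> Fq_linear_map q g.
Proof.
move=> fK gK [fD fZ]; split=> [x y|c x cq]; apply: (can_inj fK).
  by rewrite fD !gK.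
by rewrite fZ // !gK.
Qed.

Lemma equiv_to_linear_linearized (C : {set 'rV[L]_n}) (A : {set 'I_n}) :
  equiv_to_linear q (proj C A) -> exists phi psi, linearized C A phi psi.
Proof.
case=> D [[D0 DD DZ] [sigma [f [flin DE]]]].
pose pos (j : 'I_#|~: A|) : 'I_n := enum_val (sigma j).
have pos_inj : injective pos by move=> i j /enum_val_inj /perm_inj.
have posA j : pos j \notin A by have := enum_valP (sigma j); rewrite inE.
have posP i : i \notin A -> exists j, pos j = i.
  move=> iA; have iA' : i \in ~: A by rewrite inE.
  exists ((sigma^-1)%g (enum_rank_in iA' i)).
  by rewrite /pos permKV enum_rankK_in.
(* The permutation is absorbed into [pos]; on [A], where the equivalence gives nothing, the identity
   serves as default. *)
pose phi i := if [pick j | pos j == i] is Some j then f j else id.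
have phiE j : phi (pos j) = f j.
  rewrite /phi; case: pickP => [j' /eqP/pos_inj -> //|/(_ j)].
  by rewrite eqxx.
have phiP i : bijective (phi i) /\ Fq_linear_map q (phi i).
  rewrite /phi; case: pickP => [j _|_]; first exact: flin.
  by split; [exists id | split].
have /fin_all_exists[psi psiP] : forall i, exists g, cancel (phi i) g /\ cancel g (phi i).
  by move=> i; have [[g gK Kg] _] := phiP i; exists g.
have phi0 i : phi i 0 = 0 by apply: Fq_linear_map0; have [] := phiP i.
have psi0 i : psi i 0 = 0 by rewrite -[in LHS](phi0 i) (psiP i).1.
exists phi, psi; split=> [i|i|i|c x xC x0]; try by [case: (psiP i) | case: (phiP i)].
pose y : 'rV[L]__ := \row_j f j ((\row_j x 0 (enum_val j) : 'rV[L]_#|~: A|) 0 (sigma j)).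
have yD : y \in D.
  rewrite DE; apply: imset_f; apply/imsetP; exists x => //.
  by rewrite inE xC; apply/forall_inP=> i /x0 ->.
have := DZ c _ yD; rewrite {1}DE => /imsetP[u /imsetP[w]].
rewrite inE => /andP[wC /forall_inP w0] -> /rowP yw {u}.
suff -> : \row_i psi i (c * phi i (x 0 i)) = w by [].
apply/rowP=> i; rewrite mxE; have [iA|/posP[j <-]] := boolP (i \in A).
  by rewrite x0 // phi0 mulr0 psi0 (eqP (w0 i iA)).
have := yw j; rewrite !mxE -/(pos j) => yj.
by rewrite phiE yj -phiE (psiP _).1.
Qed.

End CoordinateActions.

(** * The common field of the two actions *)

Section TwoProjections.
Variables (L : finFieldType) (q n k : nat) (C : {set 'rV[L]_n}).
Hypothesis kn : (k < n)%N.
Hypothesis C0 : 0 \in C.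
Hypothesis CD : forall x y, x \in C -> y \in C -> x + y \in C.
Hypothesis Ccard : #|C| = (#|L| ^ k)%N.
Hypothesis Cdist : forall x y, x \in C -> y \in C -> x != y -> (n - k + 1 <= dH x y)%N.
Variables A B : {set 'I_n}.
Hypothesis AB_disj : [disjoint A & B].
Hypothesis AB_card : (#|A| + #|B| + 2)%N = k.
Variables phi psi phi' psi' : 'I_n -> L -> L.
Hypothesis linA : linearized q C A phi psi.
Hypothesis linB : linearized q C B phi' psi'.

Let AB := A :|: B.
Let W : {set 'rV[L]_n} := [set x in C | [forall i in AB, x 0 i == 0]].
Let fA i c x := psi i (c * phi i x).
Let fB i c x := psi' i (c * phi' i x).

Let card_AB : (#|AB| + 2)%N = k.
Proof. by rewrite /AB cardsU disjoint_setI0 // cards0 subn0. Qed.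

Let WP x : reflect (x \in C /\ forall i, i \in AB -> x 0 i = 0) (x \in W).
Proof.
rewrite inE; apply: (iffP andP) => -[xC x0]; split=> //.
  by move=> i iAB; apply/eqP; apply: (forall_inP x0).
by apply/forall_inP=> i /x0 ->.
Qed.

(** The [k - 2] zeros on [AB] and two further positions make up the [k] positions that determine a
    codeword. *)
Lemma W_uniq i j x y : i \notin AB -> j \notin AB -> i != j -> x \in W -> y \in W ->
  x 0 i = y 0 i -> x 0 j = y 0 j -> x = y.
Proof.
move=> iAB jAB ij /WP[xC x0] /WP[yC y0] xyi xyj.
apply: (mds_uniq (ltnW kn) Ccard Cdist (S := i |: (j |: AB))) => //.
  by rewrite !cardsU1 in_setU1 negb_or ij iAB jAB; lia.
move=> l; rewrite 2!in_setU1 => /or3P[/eqP->|/eqP->|lAB] //.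
by rewrite x0 ?y0.
Qed.

Lemma W_interp i j u v : i \notin AB -> j \notin AB -> i != j ->
  exists x, [/\ x \in W, x 0 i = u & x 0 j = v].
Proof.
move=> iAB jAB ij.
have [|x xC xv] := mds_interp (ltnW kn) Ccard Cdist (S := i |: (j |: AB))
    (fun l => if l == i then u else if l == j then v else 0).
  by rewrite !cardsU1 in_setU1 negb_or ij iAB jAB; lia.
exists x; split.
- apply/WP; split=> // l lAB; rewrite xv ?in_setU1 ?lAB ?orbT //.
  by rewrite (negPf (memPn iAB l lAB)) (negPf (memPn jAB l lAB)).
- by rewrite xv ?eqxx // !inE eqxx.
- by rewrite xv ?eqxx ?in_setU1 ?eqxx ?orbT // eq_sym (negPf ij).
Qed.

Let fA0 i c : fA i c 0 = 0.
Proof.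
have [phiK _ /(_ i)/Fq_linear_map0 phi0 _] := linA.
by rewrite /fA phi0 mulr0 -[X in psi i X]phi0 phiK.
Qed.

Let fB0 i c : fB i c 0 = 0.
Proof.
have [phiK _ /(_ i)/Fq_linear_map0 phi0 _] := linB.
by rewrite /fB phi0 mulr0 -[X in psi' i X]phi0 phiK.
Qed.

Let fA_W c x : x \in W -> \row_i fA i c (x 0 i) \in W.
Proof.
case/WP=> xC x0; have [_ _ _ act] := linA; apply/WP; split.
  by apply: act => // i iA; rewrite x0 // inE iA.
by move=> i iAB; rewrite mxE x0.
Qed.

Let fB_W c x : x \in W -> \row_i fB i c (x 0 i) \in W.
Proof.
case/WP=> xC x0; have [_ _ _ act] := linB; apply/WP; split.
  by apply: act => // i iA; rewrite x0 // inE iA orbT.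
by move=> i iAB; rewrite mxE x0.
Qed.

Definition agree i s t := forall z, fA i s z = fB i t z.

(** Take a word of [W] that vanishes at a third position [l] and has value [z] at [j]. Its images
    under [s] and [t] agree at [l] and at [i], hence everywhere. *)
Lemma agree_transport i j s t : i \notin AB -> j \notin AB ->
  agree i s t -> agree j s t.
Proof.
move=> iAB jAB ag z; have [->|ij] := eqVneq j i; first exact: ag.
(* The position [l] exists because [i], [j] and [AB] fill at most [k < n] positions. *)
have [l lN] : exists l, l \notin i |: (j |: AB).
  apply/existsP; rewrite -negb_forall; apply/negP=> /forallP allin.
  have : (#|[set: 'I_n]| <= #|i |: (j |: AB)|)%N by apply/subset_leq_card/subsetP=> l _.
  rewrite cardsT card_ord !cardsU1.
  by case: (_ \notin _); case: (_ \notin _); lia.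
move: lN; rewrite 2!in_setU1 !negb_or => /and3P[li lj lAB].
have [x [xW xl xj]] := W_interp 0 z lAB jAB lj.
have /rowP/(_ j) : \row_i fA i s (x 0 i) = \row_i fB i t (x 0 i).
  apply: (@W_uniq l i) => //; rewrite ?fA_W ?fB_W // !mxE ?ag //.
  by rewrite xl fA0 fB0.
by rewrite !mxE xj.
Qed.

(** For the transported action, [z] is the multiple of [g 1] by [f z], so a map commuting with all
    scalars is determined by its value at [g 1]. *)
Lemma commutant_scalar (f g m : L -> L) : cancel f g -> cancel g f ->
    (forall c z, m (g (c * f z)) = g (c * f (m z))) ->
  forall z, m z = g (f (m (g 1)) * f z).
Proof.
by move=> fK gK mC z; rewrite mulrC -mC gK mulr1 fK.
Qed.

Variable a : 'I_n.
Hypothesis aAB : a \notin AB.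

(** The intersection of the two images of [L] in the maps on coordinate [a], recorded through the
    scalars of the first action so as to be a subset of [L]. *)
Definition common_field : {set L} := [set s | [exists t, [forall z, fA a s z == fB a t z]]].

Lemma common_fieldP s : reflect (exists t, agree a s t) (s \in common_field).
Proof.
rewrite inE; apply: (iffP existsP) => -[t].
  by move/forallP=> e; exists t => z; apply/eqP.
by move=> e; exists t; apply/forallP=> z; apply/eqP.
Qed.

Let psi_lin i : Fq_linear_map q (psi i).
Proof. by have [phiK psiK phil _] := linA; apply: (Fq_linear_map_can (phiK i)). Qed.
Let psi'_lin i : Fq_linear_map q (psi' i).
Proof. by have [phiK psiK phil _] := linB; apply: (Fq_linear_map_can (phiK i)). Qed.

Lemma common_field_Fq c : c ^+ q = c -> c \in common_field.
Proof.
move=> cq; apply/common_fieldP; exists c => z.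
have [phiK _ _ _] := linA; have [phiK' _ _ _] := linB.
by rewrite /fA /fB (psi_lin a).2 // (psi'_lin a).2 // phiK phiK'.
Qed.

Lemma common_fieldD x y : x \in common_field -> y \in common_field -> x + y \in common_field.
Proof.
move=> /common_fieldP[t xt] /common_fieldP[u yu]; apply/common_fieldP; exists (t + u) => z.
rewrite /fA /fB !mulrDl (psi_lin a).1 (psi'_lin a).1.
by congr (_ + _); [exact: xt | exact: yu].
Qed.

Lemma common_fieldM x y : x \in common_field -> y \in common_field -> x * y \in common_field.
Proof.
move=> /common_fieldP[t xt] /common_fieldP[u yu]; apply/common_fieldP; exists (t * u) => z.
have [_ psiK _ _] := linA; have [_ psiK' _ _] := linB.
have fAM : fA a (x * y) z = fA a x (fA a y z) by rewrite /fA psiK mulrA.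
by rewrite fAM yu xt /fB psiK' mulrA.
Qed.

(* For [i] off [A], [B] and [a], the words of [W] vanishing at [i] form the graph of a
   map [P i] from coordinate [a] to coordinate [b].  Both actions intertwine [P i], so
   [(P i0)^-1 \o P i] commutes with both and is thus a scalar for each of them. *)
Lemma common_field_card : (n - k + 1 <= #|common_field|)%N.
Proof.
have [phiK psiK phil _] := linA; have [phiK' psiK' _ _] := linB.
have sizeR : #|~: AB :\ a| = (n - k + 1)%N.
  have := cardsC AB; rewrite card_ord => cAB.
  have := cardsD1 a (~: AB); rewrite in_setC aAB => cD.
  have e : (n - k + 2 = #|~: AB|)%N by lia.
  by apply: (@addnI 1); rewrite -cD -e; lia.
have /card_gt1P[b [i0 [bR i0R bi0]]] : (1 < #|~: AB :\ a|)%N by rewrite sizeR; lia.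
have RP i : i \in ~: AB :\ a -> i \notin AB /\ i != a by rewrite !inE => /andP[? ?].
have [bAB ba] := RP b bR; have [i0AB i0a] := RP i0 i0R.
have /fin_all_exists[P PP] : forall i, exists P : L -> L, i \in ~: AB :\ a ->
    forall z, exists x, [/\ x \in W, x 0 i = 0, x 0 a = z & x 0 b = P z].
  move=> i; have [iR|_] := boolP (i \in _); last by exists id.
  have [iAB ia] := RP i iR.
  have /fin_all_exists[x xP] z := W_interp 0 z iAB aAB ia.
  by exists (fun z => x z 0 b) => _ z; exists (x z); have [] := xP z.
(* Stated for an arbitrary [f] so as to cover both [fA] and [fB]. *)
have commP (f : 'I_n -> L -> L -> L) i c z : (forall c x, x \in W -> \row_i f i c (x 0 i) \in W) ->
    (forall i c, f i c 0 = 0) -> i \in ~: AB :\ a -> P i (f a c z) = f b c (P i z).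
  move=> fW f0 iR; have [iAB ia] := RP i iR.
  have [x [xW xi xa xb]] := PP i iR z.
  have [y [yW yi ya yb]] := PP i iR (f a c z).
  suff /rowP/(_ b) : y = \row_i f i c (x 0 i) by rewrite yb !mxE xb.
  apply: (@W_uniq i a) => //; first exact: fW.
    by rewrite yi mxE xi f0.
  by rewrite ya mxE xa.
have P0inj : injective (P i0).
  move=> z z' e; have [x [xW xi xa xb]] := PP i0 i0R z.
  have [y [yW yi ya yb]] := PP i0 i0R z'.
  suff xy : x = y by rewrite -xa xy ya.
  by apply: (@W_uniq b i0) => //; [rewrite xb e yb | rewrite xi yi].
have [Q PQ QP] := injF_bij P0inj.
pose m i z := Q (P i z).
have commm (f : 'I_n -> L -> L -> L) i c z : (forall c x, x \in W -> \row_i f i c (x 0 i) \in W) ->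
    (forall i c, f i c 0 = 0) -> i \in ~: AB :\ a -> m i (f a c z) = f a c (m i z).
  move=> fW f0 iR; apply: P0inj; rewrite /m QP (commP f) // [RHS](commP f) //.
  by rewrite QP.
(* The scalar by which [m i] acts in the first structure; [i0] yields 1 and [b] yields 0. *)
pose s i := phi a (m i (psi a 1)).
have sK i : i \in ~: AB :\ a -> s i \in common_field.
  move=> iR; apply/common_fieldP; exists (phi' a (m i (psi' a 1))) => z.
  have eA := commutant_scalar (phiK a) (psiK a) (fun c y => commm fA i c y fA_W fA0 iR) z.
  have eB := commutant_scalar (phiK' a) (psiK' a) (fun c y => commm fB i c y fB_W fB0 iR) z.
  by rewrite /fA /fB -eB eA.
have sinj : {in ~: AB :\ a &, injective s}.
  move=> i j iR jR /(can_inj (phiK a))/(can_inj QP) Pij.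
  apply/eqP/contraT=> ij.
  have [iAB ia] := RP i iR; have [jAB ja] := RP j jR.
  (* Equal scalars make these two words agree at [a] and [b], hence coincide; the word then vanishes
     at both [i] and [j], so it is zero, although its value at [a] is not. *)
  have [x [xW xi xa xb]] := PP i iR (psi a 1).
  have [y [yW yj ya yb]] := PP j jR (psi a 1).
  have xy : x = y by apply: (@W_uniq b a) => //; rewrite (xa, xb) (ya, yb).
  have W0 : 0 \in W by apply/WP; split=> // l _; rewrite mxE.
  have x0 : x = 0 by apply: (@W_uniq i j) => //; rewrite ?xy ?yj -?xy ?xi mxE.
  have : phi a (psi a 1) = 0 by rewrite -xa x0 mxE; exact: Fq_linear_map0 (phil a).
  by rewrite psiK => /eqP; rewrite oner_eq0.
rewrite -sizeR -(card_in_imset sinj); apply/subset_leq_card/subsetP=> _ /imsetP[i iR ->].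
exact: sK.
Qed.

(** On [A] only the second action is available. If [s] and [t] agree at [a], then [phi a \o psi' a]
    turns multiplication by [t] into multiplication by [s]. *)
Definition glued i : L -> L := if i \in A then phi a \o psi' a \o phi' i else phi i.

Lemma glued_linear i : bijective (glued i) /\ Fq_linear_map q (glued i).
Proof.
have [phiK psiK phil _] := linA; have [phiK' psiK' phil' _] := linB.
rewrite /glued; case: ifP => _; last by split=> //; exists (psi i).
split; first by exists (psi' i \o (phi' a \o psi a)) => z; rewrite /= ?phiK ?psiK' ?phiK' ?psiK.
split=> [x y|c x cq] /=.
  by rewrite (phil' i).1 (psi'_lin a).1 (phil a).1.
by rewrite (phil' i).2 // (psi'_lin a).2 // (phil a).2.
Qed.

(* [C] is the sum of its subcodes vanishing on [A] and on [B], on which [s] and [t] act. *)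
Lemma glued_scale s x : s \in common_field -> x \in C ->
  exists2 y, y \in C & forall i, glued i (y 0 i) = s * glued i (x 0 i).
Proof.
move=> /common_fieldP[t st] xC.
have [phiK psiK phil actA] := linA; have [phiK' psiK' phil' actB] := linB.
(* The summand [u] vanishes on [A] and equals [x] on [B], so that [x - u] vanishes on [B]. *)
have [|u uC uv] := mds_interp (ltnW kn) Ccard Cdist (S := AB)
    (fun l => if l \in A then 0 else x 0 l); first by lia.
have uA i : i \in A -> u 0 i = 0 by move=> iA; rewrite uv ?iA // inE iA.
have vC : x - u \in C by exact: add_closed_sub.
have vB i : i \in B -> (x - u) 0 i = 0.
  move=> iB; rewrite !mxE uv ?inE ?iB ?orbT //.
  by rewrite (disjointFl AB_disj iB) subrr.
exists (\row_i fA i s (u 0 i) + \row_i fB i t ((x - u) 0 i)).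
  by apply: CD; [apply: actA | apply: actB].
move=> i; rewrite !mxE /glued; have [iA|iA] := ifPn.
  rewrite uA // fA0 add0r subr0 /= /fB psiK'.
  by have := st (psi' a (phi' i (x 0 i))); rewrite /fB psiK' => <-; rewrite /fA psiK.
have [iB|iB] := boolP (i \in B).
  by have := vB i iB; rewrite !mxE => /[dup] /subr0_eq <- ->; rewrite fB0 addr0 /fA psiK.
have iAB : i \notin AB by rewrite inE negb_or iA.
(* Off [A] and [B] both actions are present; agreement carried over from [a] lets additivity
   recombine the two summands. *)
rewrite -(agree_transport aAB iAB st) /fA -(psi_lin i).1 -mulrDr -(phil i).1 psiK.
by rewrite subrKC.
Qed.

End TwoProjections.

(** * From the common field to an equivalent code *)

Theorem theorem1p2 (q h k n : nat) (L : finFieldType)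
  (Hq : prime_power q) (Hh : (1 <= h)%N) (Hk : (3 < k)%N)
  (HL : #|L| = (q ^ h)%N)
  (C : {set 'rV[L]_n})
  (HClin : sub_linear q C)
  (Hcard : #|C| = (q ^ (h * k))%N)
  (Hdist : min_dist C (n - k + 1)%N)
  (A B : {set 'I_n})
  (HAB : [disjoint A & B])
  (HABcard : (#|A| + #|B| <= k - 2)%N)
  (HA : equiv_to_linear q (proj C A))
  (HB : equiv_to_linear q (proj C B)) :
  ((q + k < n)%N ->
     exists s : nat, [/\ (1 < s)%N, (s %| h)%N &
       exists D : {set 'rV[L]_n}, sub_linear (q ^ s) D /\ Fq_equiv q C D])
  /\
  (forall e : nat, (e %| h)%N -> (e < h)%N ->
     (forall e' : nat, (e' %| h)%N -> (e' < h)%N -> (e' <= e)%N) ->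
     (q ^ e + k < n)%N -> equiv_to_linear q C).
Proof.
have q1 : (1 < q)%N.
  by have [p [r [pp [r0 ->]]]] := Hq; rewrite -[1%N](expn0 p) ltn_exp2l ?prime_gt1.
(* Both claims follow from one lower bound on [q ^ s]. *)
have main : (k < n)%N -> exists s (D : {set 'rV[L]_n}), [/\ (s %| h)%N,
    (n - k + 1 <= q ^ s)%N, sub_linear (q ^ s) D & Fq_equiv q C D].
  move=> kn; have [C0 CD _] := HClin; have [_ Cdist] := Hdist.
  have Ccard : #|C| = (#|L| ^ k)%N by rewrite Hcard HL expnM.
  have [phi [psi linA]] := equiv_to_linear_linearized HA.
  have [phi' [psi' linB]] := equiv_to_linear_linearized HB.
  have sAB : A \subset ~: B by rewrite -disjoints_subset.
  have := cardsC B; rewrite card_ord => cB.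
  (* [A] grows inside the complement of [B] until the two sizes add up to [k - 2]. *)
  have [|A' [sAA' sA'B cA']] := @exists_intermediate_set _ A (~: B) (k - 2 - #|B|)%N sAB.
    by apply/andP; split; lia.
  have dA'B : [disjoint A' & B] by rewrite disjoints_subset.
  have cA'B : (#|A'| + #|B| + 2)%N = k by lia.
  have {}linA := linearizedS sAA' linA.
  have [a aN] : exists a, a \notin A' :|: B.
    apply/existsP; rewrite -negb_forall; apply/negP=> /forallP allin.
    have : (#|[set: 'I_n]| <= #|A' :|: B|)%N by apply/subset_leq_card/subsetP=> l _.
    by rewrite cardsT card_ord cardsU disjoint_setI0 // cards0; lia.
  pose K := common_field phi psi phi' psi' a.
  have K0 : 0 \in K by apply: (common_field_Fq linA linB); rewrite expr0n gtn_eqF // ltnW.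
  have [s [sh cK KE]] := subfield_classification Hq Hh HL K0
    (common_fieldD linA linB (a := a)) (common_fieldM linA linB (a := a))
    (common_field_Fq linA linB a).
  pose G := glued A' phi phi' psi' a.
  have Glin i : bijective (G i) /\ Fq_linear_map q (G i) := glued_linear linA linB a i.
  exists s, [set \row_j G j (x 0 ((1%g : 'S_n) j)) | x : 'rV[L]_n in C]; split=> //.
  - by rewrite -cK (common_field_card kn C0 Ccard Cdist dA'B cA'B linA linB aN).
  - split.
    + apply/imsetP; exists 0 => //; apply/rowP=> i.
      by rewrite !mxE (Fq_linear_map0 (Glin i).2).
    + move=> _ _ /imsetP[x xC ->] /imsetP[y yC ->]; apply/imsetP; exists (x + y); first exact: CD.
      by apply/rowP=> i; rewrite !mxE (Glin i).2.1.
    + move=> c _ cq /imsetP[x xC ->].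
      have cinK : c \in K by rewrite KE; apply/eqP.
      have [y yC yE] := glued_scale kn C0 CD Ccard Cdist dA'B cA'B linA linB aN cinK xC.
      by apply/imsetP; exists y => //; apply/rowP=> i; rewrite !mxE !perm1 -yE.
  - by exists 1%g, G.
split=> [qkn | e eh elt emax qkn].
  have [|s [D [sh sK Dlin Deq]]] := main; first by lia.
  exists s; split=> //; last by exists D.
  (* Here [q ^ s >= n - k + 1 > q], which forces [s > 1]. *)
  by rewrite -(ltn_exp2l _ _ q1) expn1; lia.
have [|s [D [sh sK Dlin Deq]]] := main; first by lia.
(* Now [q ^ s > q ^ e], and a divisor of [h] exceeding [e] can only be [h]. *)
have sE : s = h.
  have es : (e < s)%N by rewrite -(ltn_exp2l _ _ q1); lia.
  have := dvdn_leq Hh sh; rewrite leq_eqVlt => /predU1P[//|/(emax s sh)]; lia.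
exists D; split=> //; have [D0 DD DZ] := Dlin; split=> // c x; apply: DZ; apply/eqP.
by rewrite sE -HL -cardsT -subfield_fixed => *; rewrite inE.
Qed.
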